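(* In ICaTT, the composite of two invertible cells is invertible: for every context $\Gamma$ of ICaTT, every type $\Gamma\vdash A$ equal to $*$ or an arrow type, terms $x,y,z:A$, $f:x\to_Ay$, $g:y\to_Az$ in $\Gamma$, if $f$ and $g$ are invertible in $\Gamma$ then $f*g$ is invertible in $\Gamma$.
   Context: \textbf{CaTT.} Raw syntax: types $A::=*\mid t\to_A u$; terms $t::=x\mid\mathrm{coh}_{\Gamma,A}[\gamma]$ with $x$ a variable; contexts are finite lists $(x_1:A_1,\dots,x_k:A_k)$ and substitutions finite lists $\langle x_1\mapsto t_1,\dots,x_k\mapsto t_k\rangle$; the empty ones are $\varnothing$ and $\langle\rangle$. Contexts are identified up to renaming of variables. Substitutions act on types and terms by replacing variables, with $\mathrm{coh}_{\Gamma,A}[\delta][\gamma]=\mathrm{coh}_{\Gamma,A}[\delta\circ\gamma]$, where $\langle x_i\mapsto t_i\rangle\circ\gamma=\langle x_i\mapsto t_i[\gamma]\rangle$. Dimensions: $\dim *=-1$, $\dim(t\to_Au)=\dim A+1$, $\dim\varnothing=-1$, $\dim(\Gamma,x:A)=\max(\dim\Gamma,\dim A+1)$; a term of type $A$ has dimension $\dim A+1$. The judgements $\Gamma\vdash$ (context), $\Gamma\vdash A$ (type), $\Gamma\vdash t:A$ (term), $\Delta\vdash\gamma:\Gamma$ (substitution) are generated by the usual structural rules ($\varnothing\vdash$; $\Gamma,x:A\vdash$ if $\Gamma\vdash A$ and $x$ is fresh; $\Gamma\vdash x:A$ if $(x:A)\in\Gamma$; $\Delta\vdash\langle\rangle:\varnothing$;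 $\Delta\vdash\langle\gamma,x\mapsto t\rangle:(\Gamma,x:A)$ if $\Delta\vdash\gamma:\Gamma$, $\Gamma\vdash A$ and $\Delta\vdash t:A[\gamma]$) and: $\Gamma\vdash *$ if $\Gamma\vdash$; $\Gamma\vdash u\to_Av$ if $\Gamma\vdash u:A$ and $\Gamma\vdash v:A$ with $A$ equal to $*$ or an arrow type; and the coherence rule below. The source and target of a term of type $u\to_A v$ are $u$ and $v$; the index $A$ is often omitted. Pasting diagrams: $\Gamma\vdash_{\mathrm{ps}}x:A$ is generated by $(x:* )\vdash_{\mathrm{ps}}x:*$; if $\Gamma\vdash_{\mathrm{ps}}f:x\to_Ay$ then $\Gamma\vdash_{\mathrm{ps}}y:A$; if $\Gamma\vdash_{\mathrm{ps}}x:A$ then $(\Gamma,y:A,f:x\to_Ay)\vdash_{\mathrm{ps}}f:x\to_Ay$. $\Gamma$ is a pasting diagram if $\Gamma\vdash_{\mathrm{ps}}x:*$ for some $x$. A source (resp. target) variable of a pasting diagram is one that is not the target (resp. source) of another variable. A term uses a variable if it occurs in the term or its type. A valid type $u\to_Av$ in a pasting diagram $\Gamma$ of dimension $n$ is full if either $u$ and $v$ both use all variables of $\Gamma$, or $\dim u=\dim v=n-1$ and $u$ (resp. $v$) uses all source (resp. target) variables of $\Gamma$ of dimension at most $n-1$. Coherence rule: if $\Gamma$ is a pasting diagram, $A$ a full type in $\Gamma$ and $\Delta\vdash\gamma:\Gamma$, then $\Delta\vdash\mathrm{coh}_{\Gamma,A}[\gamma]:A[\gamma]$. Suspension $\Sigma$: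 $\Sigma\varnothing=(v^-:*,v^+:* )$ with fresh $v^\pm$, $\Sigma(\Gamma,x:A)=(\Sigma\Gamma,x:\Sigma A)$, $\Sigma *=(v^-\to_*v^+)$, $\Sigma(u\to_Av)=(\Sigma u\to_{\Sigma A}\Sigma v)$, $\Sigma x=x$, $\Sigma\mathrm{coh}_{\Gamma,A}[\gamma]=\mathrm{coh}_{\Sigma\Gamma,\Sigma A}[\Sigma\gamma]$, $\Sigma\langle\rangle=\langle v^-\mapsto v^-,v^+\mapsto v^+\rangle$, $\Sigma\langle\gamma,x\mapsto t\rangle=\langle\Sigma\gamma,x\mapsto\Sigma t\rangle$. Disks: $\mathbb D^0=(d_0:* )$, $\mathbb D^{n+1}=\Sigma\mathbb D^n$, with top-dimensional variable of $\mathbb D^n$ denoted $d_n$. A term $t$ of dimension $n$ in $\Gamma$ (with type $*$ or an arrow) corresponds to the unique substitution $\Gamma\vdash\chi_t:\mathbb D^n$ with $d_n[\chi_t]=t$ (other variables go to iterated sources and targets of $t$). Identity and composition: $\mathrm{id}\,x=\mathrm{coh}_{(x:* ),x\to x}[\mathrm{id}]$ in $(x:* )$, and $f*g=\mathrm{coh}_{\Gamma,x\to z}[\mathrm{id}]:x\to z$ in $\Gamma=(x:*,y:*,f:x\to y,z:*,g:y\to z)$; by suspending and substituting, $\mathrm{id}\,x$ and $f*g$ are defined for terms $x:A$, $f:x\to_Ay$, $g:y\to_Az$ of any dimension in any context. \textbf{ICaTT} keeps all rules of CaTT and adds a type constructor $\mathrm{Inv}_A(t)$ (index often omitted) and term constructors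 $\mathrm{can}(t,\{e_x\})$, $\mathrm{coind}(t,t_l,t_r,t_{lu},t_{ru},t_{ilu},t_{iru})$, $\mathrm{rec}(t,t_l,t_r,t_{lu},t_{ru},t_{ilu},t_{iru},\gamma)$, $\mathrm{linv}(t)$, $\mathrm{rinv}(t)$, $\mathrm{lunit}(t)$, $\mathrm{runit}(t)$, $\mathrm{ilunit}(t)$, $\mathrm{irunit}(t)$. Suspension commutes with all new constructors. Substitution commutes with all of them except $\mathrm{rec}(\dots,\gamma)[\sigma]=\mathrm{rec}(\dots,\gamma\circ\sigma)$. Judgemental equality $\equiv$ is the congruence generated by the computation rules below; typing is up to $\equiv$. (Inv) If $\Gamma\vdash t:u\to_Av$ then $\Gamma\vdash\mathrm{Inv}(t)$. (Destructors) If $\Gamma\vdash e:\mathrm{Inv}(t)$ with $t:u\to v$, then $\mathrm{linv}(e):v\to u$, $\mathrm{rinv}(e):v\to u$, $\mathrm{lunit}(e):\mathrm{linv}(e)*t\to\mathrm{id}\,v$, $\mathrm{runit}(e):t*\mathrm{rinv}(e)\to\mathrm{id}\,u$, $\mathrm{ilunit}(e):\mathrm{Inv}(\mathrm{lunit}(e))$, $\mathrm{irunit}(e):\mathrm{Inv}(\mathrm{runit}(e))$ in $\Gamma$. (coind) If in $\Gamma$: $t:x\to y$, $t_l,t_r:y\to x$, $t_{lu}:t_l*t\to\mathrm{id}\,y$, $t_{ru}:t*t_r\to\mathrm{id}\,x$, $t_{ilu}:\mathrm{Inv}(t_{lu})$, $t_{iru}:\mathrm{Inv}(t_{ru})$,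 then $\mathrm{coind}(t,t_l,t_r,t_{lu},t_{ru},t_{ilu},t_{iru}):\mathrm{Inv}(t)$. The six $\beta$-rules say that $\mathrm{linv},\mathrm{rinv},\mathrm{lunit},\mathrm{runit},\mathrm{ilunit},\mathrm{irunit}$ of this term are $t_l,t_r,t_{lu},t_{ru},t_{ilu},t_{iru}$ respectively; the $\eta$-rule is $e\equiv\mathrm{coind}(t,\mathrm{linv}(e),\mathrm{rinv}(e),\mathrm{lunit}(e),\mathrm{runit}(e),\mathrm{ilunit}(e),\mathrm{irunit}(e))$ for $e:\mathrm{Inv}(t)$. (can) If $\Delta\vdash t=\mathrm{coh}_{\Gamma,A}[\gamma]:A[\gamma]$ with $\dim A=n$, and $\Delta\vdash e_x:\mathrm{Inv}(x[\gamma])$ for every $(n+1)$-dimensional variable $x$ of $\Gamma$, then $\Delta\vdash\mathrm{can}(t,\{e_x\}):\mathrm{Inv}(t)$. Its $\beta$-rules: $\mathrm{linv},\mathrm{rinv},\mathrm{lunit},\mathrm{runit}$ of $\mathrm{can}(t,\{e_x\})$ are terms $t^{L},t^{R},t^{LU},t^{RU}$ and $\mathrm{ilunit},\mathrm{irunit}$ of it are $\mathrm{can}(t^{LU},\{-\})$, $\mathrm{can}(t^{RU},\{-\})$, as follows. Write $A=u\to v$ and let $\Gamma^{op}$ be the pasting diagram obtained from $\Gamma$ by exchanging source and target of all $(n+1)$-dimensional variables (and reordering). Then $t^L=\mathrm{coh}_{\Gamma^{op},v\to u}[\gamma^L]$, with $\gamma^L$ equal to $\gamma$ on variables of dimension $\le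 n$ and $x\mapsto\mathrm{linv}(e_x)$ on $(n+1)$-dimensional ones; $t^R$ is the same with $\mathrm{rinv}$. $t^{LU}:t^L*t\to\mathrm{id}$ and $t^{RU}:t*t^R\to\mathrm{id}$ are coherence terms: if $\dim\Gamma\le n$, a coherence over $\Gamma$ applied to $\gamma$; if $\dim\Gamma=n+1$, a composite of an associator grouping chains of arguments with their inverses, a cancellation of these using $\mathrm{lunit}(e_x)$ (resp. $\mathrm{runit}(e_x)$), and a unitor; $\{-\}$ is the resulting family of invertibility terms for their top-dimensional arguments, built from $\mathrm{can}$ and $\mathrm{ilunit}(e_x)$ (resp. $\mathrm{irunit}(e_x)$). This is a fixed choice (following the construction of Benjamin and Markakis), stable under substitution and suspension. (rec) Let $\mathbb E^{n+1}=(\mathbb D^{n+1},e_{n+1}:\mathrm{Inv}(d_{n+1}))$; then $\Sigma\mathbb E^{n+1}=\mathbb E^{n+2}$. For $\Gamma\vdash e:\mathrm{Inv}(t)$ with $t$ of dimension $n+1$, $\Gamma\vdash\chi_e:\mathbb E^{n+1}$ is the substitution extending $\chi_t$ by $e_{n+1}\mapsto e$. For $\mathbb E^{n+1}\vdash t:x\to y$ let $\mathbb E^{n+1}_t=(\mathbb E^{n+1},\,h^-:\mathrm{Inv}(\Sigma t)[\chi_{\mathrm{ilunit}(e_{n+1})}],\,h^+:\mathrm{Inv}(\Sigma t)[\chi_{\mathrm{irunit}(e_{n+1})}])$. If in $\mathbb E^{n+1}$: $t:x\to y$, $t_l,t_r:y\to x$, $t_{lu}:t_l*t\to\mathrm{id}\,y$,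 $t_{ru}:t*t_r\to\mathrm{id}\,x$, and in $\mathbb E^{n+1}_t$: $t_{ilu}:\mathrm{Inv}(t_{lu})$, $t_{iru}:\mathrm{Inv}(t_{ru})$, and $\Gamma\vdash\gamma:\mathbb E^{n+1}$, then $\Gamma\vdash\mathrm{rec}(t,t_l,t_r,t_{lu},t_{ru},t_{ilu},t_{iru},\gamma):\mathrm{Inv}(t[\gamma])$. $\beta$-rules: $\mathrm{linv},\mathrm{rinv},\mathrm{lunit},\mathrm{runit}$ of it are $t_l[\gamma],t_r[\gamma],t_{lu}[\gamma],t_{ru}[\gamma]$, and $\mathrm{ilunit},\mathrm{irunit}$ of it are $t_{ilu}[\langle r\rangle\circ\gamma]$, $t_{iru}[\langle r\rangle\circ\gamma]$, where $r=\mathrm{rec}(t,t_l,t_r,t_{lu},t_{ru},t_{ilu},t_{iru},\mathrm{id}_{\mathbb E^{n+1}})$ and $\langle r\rangle=\langle\mathrm{id}_{\mathbb E^{n+1}},h^-\mapsto(\Sigma r)[\chi_{\mathrm{ilunit}(e_{n+1})}],h^+\mapsto(\Sigma r)[\chi_{\mathrm{irunit}(e_{n+1})}]\rangle$. \textbf{Convention.} A term $\Gamma\vdash t:u\to v$ of ICaTT is called invertible in $\Gamma$ if there is a term $\Gamma\vdash e:\mathrm{Inv}(t)$ (an invertibility structure on $t$). *)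

(* Defs.v *)
From Stdlib Require List.
From mathcomp Require Import all_boot.

Set Implicit Arguments.
Unset Strict Implicit.
Unset Printing Implicit Defensive.

(* Variables are de Bruijn levels: [Var i] is the i-th variable of the context,
   counted from the left.  Contexts are thereby identified up to renaming, and
   context extension ([rcons]) leaves the types already present unchanged.  The
   only subterms living in a scope other than the ambient one are [G] and [A] in
   [Coh G A g] and all arguments but the last of [Rec], so no operation below
   needs shifting under binders. *)

(* The side of a piece of invertibility data: [sL] for linv, lunit, ilunit and
   [sR] for rinv, runit, irunit. *)
Inductive side := sL | sR.

Definition pick_side (T : Type) (s : side) (a b : T) : T :=
  if s is sL then a else b.

(* In [Inv A t], [A] is the type of [t].
   In [Can t es], [es] lists the e_x in the order in which the relevant variables
   x occur in the pasting diagram of the coherence term [t].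
   The scope of the first arguments of [Rec n t .. g] is E^(n+1); n is recorded
   explicitly. *)
Inductive ty : Type :=
  | Star
  | Arr (A : ty) (u v : tm)
  | Inv (A : ty) (t : tm)
with tm : Type :=
  | Var (i : nat)
  | Coh (G : seq ty) (A : ty) (g : seq tm)
  | Can (t : tm) (es : seq tm)
  | Coind (t tl tr tlu tru tilu tiru : tm)
  | Rec (n : nat) (t tl tr tlu tru tilu tiru : tm) (g : seq tm)
  | Dinv (s : side) (e : tm)
  | Dunit (s : side) (e : tm)
  | Diunit (s : side) (e : tm).

Notation linv := (Dinv sL).
Notation rinv := (Dinv sR).
Notation lunit := (Dunit sL).
Notation runit := (Dunit sR).
Notation ilunit := (Diunit sL).
Notation irunit := (Diunit sR).

Definition ctx := seq ty.
Definition sub := seq tm.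

Fixpoint substt (t : tm) (d : sub) : tm :=
  match t with
  | Var i => nth (Var 0) d i
  | Coh G A g => Coh G A (map (fun u => substt u d) g)
  | Can u es => Can (substt u d) (map (fun e => substt e d) es)
  | Coind a al ar alu aru ailu airu =>
      Coind (substt a d) (substt al d) (substt ar d) (substt alu d)
        (substt aru d) (substt ailu d) (substt airu d)
  | Rec n a al ar alu aru ailu airu g =>
      Rec n a al ar alu aru ailu airu (map (fun u => substt u d) g)
  | Dinv s e => Dinv s (substt e d)
  | Dunit s e => Dunit s (substt e d)
  | Diunit s e => Diunit s (substt e d)
  end.

Fixpoint substT (A : ty) (d : sub) : ty :=
  match A with
  | Star => Star
  | Arr B u v => Arr (substT B d) (substt u d) (substt v d)
  | Inv B t => Inv (substT B d) (substt t d)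
  end.

Definition comps (g d : sub) : sub := map (fun u => substt u d) g.

Definition ids (k : nat) : sub := mkseq Var k.

(* The new variables v^- and v^+ of a suspension are [Var 0] and [Var 1]. *)
Fixpoint suspT (A : ty) : ty :=
  match A with
  | Star => Arr Star (Var 0) (Var 1)
  | Arr B u v => Arr (suspT B) (suspt u) (suspt v)
  | Inv B t => Inv (suspT B) (suspt t)
  end
with suspt (t : tm) : tm :=
  match t with
  | Var i => Var i.+2
  | Coh G A g =>
      Coh [:: Star, Star & map suspT G] (suspT A) [:: Var 0, Var 1 & map suspt g]
  | Can u es => Can (suspt u) (map suspt es)
  | Coind a al ar alu aru ailu airu =>
      Coind (suspt a) (suspt al) (suspt ar) (suspt alu) (suspt aru)
        (suspt ailu) (suspt airu)
  | Rec n a al ar alu aru ailu airu g =>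
      Rec n.+1 (suspt a) (suspt al) (suspt ar) (suspt alu) (suspt aru)
        (suspt ailu) (suspt airu) [:: Var 0, Var 1 & map suspt g]
  | Dinv s e => Dinv s (suspt e)
  | Dunit s e => Dunit s (suspt e)
  | Diunit s e => Diunit s (suspt e)
  end.

Definition suspC (G : ctx) : ctx := [:: Star, Star & map suspT G].

(* [dim1 A] is dim A + 1, the dimension of the terms of type A; the value on
   [Inv] is irrelevant, such types having no dimension. *)
Fixpoint dim1 (A : ty) : nat :=
  match A with
  | Star => 0
  | Arr B _ _ => (dim1 B).+1
  | Inv _ _ => 0
  end.

Definition nth_ty (G : ctx) (i : nat) : ty := nth Star G i.

(* The dimension of a nonempty context (it is only used on pasting diagrams). *)
Definition dimC (G : ctx) : nat := \max_(A <- G) dim1 A.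

Definition globular (A : ty) : bool :=
  match A with Star | Arr _ _ _ => true | Inv _ _ => false end.

(* [ps G x A] is the judgement G |-ps x : A, in which x is always a variable. *)
Inductive ps : ctx -> tm -> ty -> Prop :=
  | ps_pt : ps [:: Star] (Var 0) Star
  | ps_down G f x A y : ps G f (Arr A x y) -> ps G y A
  | ps_up G x A : ps G x A ->
      ps (rcons (rcons G A) (Arr A x (Var (size G))))
         (Var (size G).+1) (Arr A x (Var (size G))).

Definition pasting (G : ctx) : Prop := exists x, ps G x Star.

Fixpoint occt (i : nat) (t : tm) : bool :=
  match t with
  | Var j => i == j
  | Coh _ _ g => has (occt i) g
  | Can u es => occt i u || has (occt i) es
  | Coind a al ar alu aru ailu airu =>
      [|| occt i a, occt i al, occt i ar, occt i alu, occt i aru, occt i ailu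
        | occt i airu]
  | Rec _ _ _ _ _ _ _ _ g => has (occt i) g
  | Dinv _ e => occt i e
  | Dunit _ e => occt i e
  | Diunit _ e => occt i e
  end.

Fixpoint occT (i : nat) (A : ty) : bool :=
  match A with
  | Star => false
  | Arr B u v => [|| occT i B, occt i u | occt i v]
  | Inv B t => occT i B || occt i t
  end.

Definition uses (A : ty) (t : tm) (i : nat) : bool := occt i t || occT i A.

Definition source_var (G : ctx) (i : nat) : Prop :=
  ~ exists2 j, j < size G & exists A u, nth_ty G j = Arr A u (Var i).

Definition target_var (G : ctx) (i : nat) : Prop :=
  ~ exists2 j, j < size G & exists A v, nth_ty G j = Arr A (Var i) v.

(* In the second alternative, u and v have dimension [dim1 A]. *)
Definition full (G : ctx) (B : ty) : Prop :=
  match B with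
  | Arr A u v =>
      (forall i, i < size G -> uses A u i /\ uses A v i)
      \/ [/\ (dim1 A).+1 = dimC G,
             forall i, i < size G -> dim1 (nth_ty G i) < dimC G ->
               source_var G i -> uses A u i
           & forall i, i < size G -> dim1 (nth_ty G i) < dimC G ->
               target_var G i -> uses A v i]
  | _ => False
  end.

(* The type of d_n, the last variable [Var n.*2] of D^n. *)
Definition sphere (n : nat) : ty := iter n suspT Star.

Definition disk (n : nat) : ctx := iter n suspC [:: Star].

(* chi_t, for t of type A. *)
Fixpoint bound (A : ty) : sub :=
  match A with Arr B u v => bound B ++ [:: u; v] | _ => [::] end.

Definition chi (A : ty) (t : tm) : sub := rcons (bound A) t.

(* chi_e, for e : Inv(t) and t of type A. *)
Definition chiE (A : ty) (t e : tm) : sub := rcons (chi A t) e.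

Definition idn0 : tm := Coh [:: Star] (Arr Star (Var 0) (Var 0)) (ids 1).

Definition idn (A : ty) (x : tm) : tm :=
  substt (iter (dim1 A) suspt idn0) (chi A x).

Definition chain2 : ctx :=
  [:: Star; Star; Arr Star (Var 0) (Var 1); Star; Arr Star (Var 1) (Var 3)].

Definition comp0 : tm := Coh chain2 (Arr Star (Var 0) (Var 3)) (ids 5).

(* The composite f * g of f : x ->_A y and g : y ->_A z. *)
Definition compn (A : ty) (x y z f g : tm) : tm :=
  substt (iter (dim1 A) suspt comp0) (bound A ++ [:: x; y; f; z; g]).

Definition chain3 : ctx :=
  [:: Star; Star; Arr Star (Var 0) (Var 1); Star; Arr Star (Var 1) (Var 3);
      Star; Arr Star (Var 3) (Var 5)].

Definition comp30 : tm := Coh chain3 (Arr Star (Var 0) (Var 5)) (ids 7).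

Definition compn3 (A : ty) (w x y z f g h : tm) : tm :=
  substt (iter (dim1 A) suspt comp30) (bound A ++ [:: w; x; f; y; g; z; h]).

(* For t : u ->_A v with inverse ti on the side s. *)
Definition unit_dom (s : side) (A : ty) (u v t ti : tm) : tm :=
  pick_side s (compn A v u v ti t) (compn A u v u t ti).

Definition unit_cod (s : side) (A : ty) (u v : tm) : tm :=
  pick_side s (idn A v) (idn A u).

Definition unit_ty (s : side) (A : ty) (u v t ti : tm) : ty :=
  Arr (pick_side s (Arr A v v) (Arr A u u))
    (unit_dom s A u v t ti) (unit_cod s A u v).

(* The variables of G of dimension dim A + 1. *)
Definition topvars (G : ctx) (A : ty) : seq nat :=
  [seq i <- iota 0 (size G) | dim1 (nth_ty G i) == dim1 A].

Definition swap_top (m : nat) (A : ty) : ty :=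
  match A with
  | Arr B u v => if dim1 A == m then Arr B v u else A
  | _ => A
  end.

(* [G'] is the pasting diagram obtained from [G] by exchanging source and target
   of its variables of dimension m; the variable i of [G] becomes the variable
   [nth 0 p i] of [G'].  Such [G'] and [p] are unique. *)
Definition is_op (m : nat) (G G' : ctx) (p : seq nat) : Prop :=
  [/\ pasting G', size G' = size G, perm_eq p (iota 0 (size G))
    & forall i, i < size G ->
        nth_ty G' (nth 0 p i) = substT (swap_top m (nth_ty G i)) (map Var p)].

(* The substitution gamma^L or gamma^R, on the variables of G. *)
Definition can_args (s : side) (G : ctx) (A : ty) (g es : sub) : sub :=
  [seq (if dim1 (nth_ty G i) == dim1 A
        then Dinv s (nth (Var 0) es (index i (topvars G A)))
        else nth (Var 0) g i) | i <- iota 0 (size G)].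

(* The terms t^L and t^R, for t = coh_{G, u ->_B v}[g] and [is_op _ G G' p]. *)
Definition can_inv (s : side) (G' : ctx) (p : seq nat) (G : ctx) (B : ty)
    (u v : tm) (g es : sub) : tm :=
  let h := can_args s G (Arr B u v) g es in
  Coh G' (substT (Arr B v u) (map Var p))
    [seq nth (Var 0) h (index j p) | j <- iota 0 (size G)].

(* G extended with a variable e_x : Inv(x) for each x in topvars G A.  Stability
   under substitution means that t^LU, t^RU and the families {-} are determined
   by their values at the generic instance (gamma = id, e_x a variable) in this
   context. *)
Definition gen_ctx (G : ctx) (A : ty) : ctx :=
  G ++ [seq Inv (nth_ty G i) (Var i) | i <- topvars G A].

Definition gen_es (G : ctx) (A : ty) : sub :=
  [seq Var (size G + j) | j <- iota 0 (size (topvars G A))].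

(* The fixed choice of t^LU, t^RU and {-}, at the generic instance and when
   dim G = dim A + 1; [cunit sL], [cunit sR] give t^LU, t^RU. *)
Record choice_can := ChoiceCan {
  cunit : side -> ctx -> ty -> tm;
  cfam : side -> ctx -> ty -> sub
}.

(* The generic t^LU and t^RU.  If dim G <= dim A, then G^op = G and they are
   coherences over G. *)
Definition gen_unit (C : choice_can) (s : side) (G : ctx) (A : ty) : tm :=
  if dimC G < dim1 A then
    match A with
    | Arr B u v =>
        Coh G (unit_ty s B u v (Coh G (Arr B u v) (ids (size G)))
                               (Coh G (Arr B v u) (ids (size G))))
          (ids (size G))
    | _ => Var 0
    end
  else cunit C s G A.

Definition gen_fam (C : choice_can) (s : side) (G : ctx) (A : ty) : sub :=
  if dimC G < dim1 A then [::] else cfam C s G A.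

(* E^n, for n >= 1; its last two variables are d_n and e_n. *)
Definition ectx (n : nat) : ctx := rcons (disk n) (Inv (sphere n) (Var n.*2)).

Definition evar (n : nat) : tm := Var n.*2.+1.

(* chi_{ilunit(e_n)} or chi_{irunit(e_n)}, from E^n to E^(n+1). *)
Definition chi_iunit (s : side) (n : nat) : sub :=
  match sphere n with
  | Arr A u v =>
      chiE (unit_ty s A u v (Var n.*2) (Dinv s (evar n)))
        (Dunit s (evar n)) (Diunit s (evar n))
  | _ => [::]
  end.

(* E^n_t, for t of type A. *)
Definition ectx_rec (n : nat) (A : ty) (t : tm) : ctx :=
  ectx n ++ [:: substT (suspT (Inv A t)) (chi_iunit sL n);
                substT (suspT (Inv A t)) (chi_iunit sR n)].

(* The substitution <r>. *)
Definition rec_sub (n : nat) (r : tm) : sub :=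
  ids (size (ectx n)) ++ [:: substt (suspt r) (chi_iunit sL n);
                             substt (suspt r) (chi_iunit sR n)].

(* The rules [wf_Arr], [wf_conv] carry as explicit premises the usual
   presupposition that the type of a term is well formed.  The family premise of
   [wf_Can] indexes the e_x by their position in [topvars G A]. *)

Section Judgements.
Variable C : choice_can.

Inductive wf_ctx : ctx -> Prop :=
  | wf_nil : wf_ctx [::]
  | wf_rcons G A : wf_ty G A -> wf_ctx (rcons G A)

with wf_ty : ctx -> ty -> Prop :=
  | wf_Star G : wf_ctx G -> wf_ty G Star
  | wf_Arr G A u v : globular A -> wf_ty G A -> wf_tm G u A -> wf_tm G v A ->
      wf_ty G (Arr A u v)
  | wf_Inv G A u v t : wf_tm G t (Arr A u v) -> wf_ty G (Inv (Arr A u v) t)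

with wf_tm : ctx -> tm -> ty -> Prop :=
  | wf_conv G t A B : wf_tm G t A -> eq_ty G A B -> wf_ty G B -> wf_tm G t B
  | wf_Var G i : wf_ctx G -> i < size G -> wf_tm G (Var i) (nth_ty G i)
  | wf_Coh D G A g : pasting G -> wf_ty G A -> full G A -> wf_sub D g G ->
      wf_tm D (Coh G A g) (substT A g)
  | wf_Can D G A g es :
      wf_tm D (Coh G A g) (substT A g) ->
      size es = size (topvars G A) ->
      (forall j, j < size es ->
         let x := nth 0 (topvars G A) j in
         wf_tm D (nth (Var 0) es j)
           (Inv (substT (nth_ty G x) g) (substt (Var x) g))) ->
      wf_tm D (Can (Coh G A g) es) (Inv (substT A g) (Coh G A g))
  | wf_Coind G A x y t tl tr tlu tru tilu tiru :
      wf_tm G t (Arr A x y) ->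
      wf_tm G tl (Arr A y x) ->
      wf_tm G tr (Arr A y x) ->
      wf_tm G tlu (unit_ty sL A x y t tl) ->
      wf_tm G tru (unit_ty sR A x y t tr) ->
      wf_tm G tilu (Inv (unit_ty sL A x y t tl) tlu) ->
      wf_tm G tiru (Inv (unit_ty sR A x y t tr) tru) ->
      wf_tm G (Coind t tl tr tlu tru tilu tiru) (Inv (Arr A x y) t)
  | wf_Rec G n A x y t tl tr tlu tru tilu tiru g :
      wf_tm (ectx n.+1) t (Arr A x y) ->
      wf_tm (ectx n.+1) tl (Arr A y x) ->
      wf_tm (ectx n.+1) tr (Arr A y x) ->
      wf_tm (ectx n.+1) tlu (unit_ty sL A x y t tl) ->
      wf_tm (ectx n.+1) tru (unit_ty sR A x y t tr) ->
      wf_tm (ectx_rec n.+1 (Arr A x y) t) tilu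
        (Inv (unit_ty sL A x y t tl) tlu) ->
      wf_tm (ectx_rec n.+1 (Arr A x y) t) tiru
        (Inv (unit_ty sR A x y t tr) tru) ->
      wf_sub G g (ectx n.+1) ->
      wf_tm G (Rec n t tl tr tlu tru tilu tiru g)
        (Inv (substT (Arr A x y) g) (substt t g))
  | wf_Dinv G s A u v t e : wf_tm G e (Inv (Arr A u v) t) ->
      wf_tm G (Dinv s e) (Arr A v u)
  | wf_Dunit G s A u v t e : wf_tm G e (Inv (Arr A u v) t) ->
      wf_tm G (Dunit s e) (unit_ty s A u v t (Dinv s e))
  | wf_Diunit G s A u v t e : wf_tm G e (Inv (Arr A u v) t) ->
      wf_tm G (Diunit s e) (Inv (unit_ty s A u v t (Dinv s e)) (Dunit s e))

(* [wf_sub D g G] is the judgement D |- g : G. *)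
with wf_sub : ctx -> sub -> ctx -> Prop :=
  | wf_snil D : wf_ctx D -> wf_sub D [::] [::]
  | wf_srcons D g t G A : wf_sub D g G -> wf_ty G A -> wf_tm D t (substT A g) ->
      wf_sub D (rcons g t) (rcons G A)

with eq_ctx : ctx -> ctx -> Prop :=
  | eq_nil : eq_ctx [::] [::]
  | eq_rcons G G' A A' : eq_ctx G G' -> eq_ty G A A' ->
      eq_ctx (rcons G A) (rcons G' A')

with eq_ty : ctx -> ty -> ty -> Prop :=
  | eqT_refl G A : eq_ty G A A
  | eqT_sym G A B : eq_ty G A B -> eq_ty G B A
  | eqT_trans G A B B' : eq_ty G A B -> eq_ty G B B' -> eq_ty G A B'
  | eqT_Arr G A A' u u' v v' :
      eq_ty G A A' -> eq_tm G u u' -> eq_tm G v v' ->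
      eq_ty G (Arr A u v) (Arr A' u' v')
  | eqT_Inv G A A' t t' : eq_ty G A A' -> eq_tm G t t' ->
      eq_ty G (Inv A t) (Inv A' t')

with eq_tm : ctx -> tm -> tm -> Prop :=
  | eqt_refl G t : eq_tm G t t
  | eqt_sym G t u : eq_tm G t u -> eq_tm G u t
  | eqt_trans G t u v : eq_tm G t u -> eq_tm G u v -> eq_tm G t v
  | eqt_Coh D G G' A A' g g' :
      eq_ctx G G' -> eq_ty G A A' -> eq_sub D g g' ->
      eq_tm D (Coh G A g) (Coh G' A' g')
  | eqt_Can D t t' es es' : eq_tm D t t' -> eq_sub D es es' ->
      eq_tm D (Can t es) (Can t' es')
  | eqt_Coind G t t' tl tl' tr tr' tlu tlu' tru tru' tilu tilu' tiru tiru' :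
      eq_tm G t t' -> eq_tm G tl tl' -> eq_tm G tr tr' -> eq_tm G tlu tlu' ->
      eq_tm G tru tru' -> eq_tm G tilu tilu' -> eq_tm G tiru tiru' ->
      eq_tm G (Coind t tl tr tlu tru tilu tiru)
              (Coind t' tl' tr' tlu' tru' tilu' tiru')
  | eqt_Rec G n A t t' tl tl' tr tr' tlu tlu' tru tru' tilu tilu' tiru tiru'
        g g' :
      wf_tm (ectx n.+1) t A ->
      eq_tm (ectx n.+1) t t' -> eq_tm (ectx n.+1) tl tl' ->
      eq_tm (ectx n.+1) tr tr' -> eq_tm (ectx n.+1) tlu tlu' ->
      eq_tm (ectx n.+1) tru tru' ->
      eq_tm (ectx_rec n.+1 A t) tilu tilu' ->
      eq_tm (ectx_rec n.+1 A t) tiru tiru' ->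
      eq_sub G g g' ->
      eq_tm G (Rec n t tl tr tlu tru tilu tiru g)
              (Rec n t' tl' tr' tlu' tru' tilu' tiru' g')
  | eqt_Dinv G s e e' : eq_tm G e e' -> eq_tm G (Dinv s e) (Dinv s e')
  | eqt_Dunit G s e e' : eq_tm G e e' -> eq_tm G (Dunit s e) (Dunit s e')
  | eqt_Diunit G s e e' : eq_tm G e e' -> eq_tm G (Diunit s e) (Diunit s e')
  | beta_Coind_inv G s T t tl tr tlu tru tilu tiru :
      let e := Coind t tl tr tlu tru tilu tiru in
      wf_tm G e T -> eq_tm G (Dinv s e) (pick_side s tl tr)
  | beta_Coind_unit G s T t tl tr tlu tru tilu tiru :
      let e := Coind t tl tr tlu tru tilu tiru in
      wf_tm G e T -> eq_tm G (Dunit s e) (pick_side s tlu tru)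
  | beta_Coind_iunit G s T t tl tr tlu tru tilu tiru :
      let e := Coind t tl tr tlu tru tilu tiru in
      wf_tm G e T -> eq_tm G (Diunit s e) (pick_side s tilu tiru)
  | eta_Inv G T t e : wf_tm G e (Inv T t) ->
      eq_tm G e (Coind t (linv e) (rinv e) (lunit e) (runit e)
                   (ilunit e) (irunit e))
  | beta_Can_inv D s T G B u v g es G' p :
      let e := Can (Coh G (Arr B u v) g) es in
      wf_tm D e T -> is_op (dim1 (Arr B u v)) G G' p ->
      eq_tm D (Dinv s e) (can_inv s G' p G B u v g es)
  | beta_Can_unit D s T G A g es :
      let e := Can (Coh G A g) es in
      wf_tm D e T -> dimC G <= dim1 A ->
      eq_tm D (Dunit s e) (substt (gen_unit C s G A) (g ++ es))
  | beta_Can_iunit D s T G A g es :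
      let e := Can (Coh G A g) es in
      wf_tm D e T -> dimC G <= dim1 A ->
      eq_tm D (Diunit s e)
        (Can (substt (gen_unit C s G A) (g ++ es))
             (comps (gen_fam C s G A) (g ++ es)))
  | beta_Rec_inv G s T n t tl tr tlu tru tilu tiru g :
      let e := Rec n t tl tr tlu tru tilu tiru g in
      wf_tm G e T -> eq_tm G (Dinv s e) (substt (pick_side s tl tr) g)
  | beta_Rec_unit G s T n t tl tr tlu tru tilu tiru g :
      let e := Rec n t tl tr tlu tru tilu tiru g in
      wf_tm G e T -> eq_tm G (Dunit s e) (substt (pick_side s tlu tru) g)
  | beta_Rec_iunit G s T n t tl tr tlu tru tilu tiru g :
      let e := Rec n t tl tr tlu tru tilu tiru g in
      let r := Rec n t tl tr tlu tru tilu tiru (ids (size (ectx n.+1))) in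
      wf_tm G e T ->
      eq_tm G (Diunit s e)
        (substt (pick_side s tilu tiru) (comps (rec_sub n.+1 r) g))

with eq_sub : ctx -> sub -> sub -> Prop :=
  | eqs_nil G : eq_sub G [::] [::]
  | eqs_cons G t t' g g' : eq_tm G t t' -> eq_sub G g g' ->
      eq_sub G (t :: g) (t' :: g').

Definition invertible (G : ctx) (A : ty) (t : tm) : Prop :=
  exists e, wf_tm G e (Inv A t).

End Judgements.

(* Terms built by coherences from atoms satisfying [P]. *)
Inductive coh_built (P : tm -> Prop) : tm -> Prop :=
  | built_atom t : P t -> coh_built P t
  | built_Coh G A g : (forall t, List.In t g -> coh_built P t) ->
      coh_built P (Coh G A g).

(* A coherence term over a diagram of dimension at most m. *)
Definition coh_dim_le (m : nat) (t : tm) : Prop :=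
  exists G A g, t = Coh G A g /\ dimC G <= m.

Definition atom_var (G : ctx) (t : tm) : Prop :=
  exists2 i, i < size G & t = Var i.

Definition atom_inv (s : side) (G : ctx) (A : ty) (t : tm) : Prop :=
  atom_var G t \/ exists2 e, List.In e (gen_es G A) & t = Dinv s e.

Definition atom_unit (s : side) (G : ctx) (A : ty) (t : tm) : Prop :=
  atom_inv s G A t \/ exists2 e, List.In e (gen_es G A) & t = Dunit s e.

(* Invertibility terms built from can and ilunit(e_x) (or irunit(e_x)). *)
Inductive inv_built (s : side) (es : sub) : tm -> Prop :=
  | built_iunit e : List.In e es -> inv_built s es (Diunit s e)
  | built_Can t fs : (forall f, List.In f fs -> inv_built s es f) ->
      inv_built s es (Can t fs).

(* The non-coherence cells composed by a term, from left to right. *)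
Fixpoint leaves (t : tm) : seq tm :=
  match t with
  | Coh G A g =>
      flatten (mask [seq dim1 B == dim1 A | B <- G] (map leaves g))
  | _ => [:: t]
  end.

(* A sequence of consecutively composable variables. *)
Definition composable (G : ctx) (xs : seq nat) : Prop :=
  xs <> [::] /\
  forall k, k.+1 < size xs ->
    exists B u v w, nth_ty G (nth 0 xs k) = Arr B u v
                    /\ nth_ty G (nth 0 xs k.+1) = Arr B v w.

(* x_k^L * .. * x_1^L * x_1 * .. * x_k, or x_1 * .. * x_k * x_k^R * .. * x_1^R. *)
Definition chain_with_inv (s : side) (G : ctx) (A : ty) (xs : seq nat) : sub :=
  let inv x := Dinv s (Var (size G + index x (topvars G A))) in
  pick_side s (map inv (rev xs) ++ map Var xs) (map Var xs ++ map inv (rev xs)).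

(* The term p composes the top-dimensional variables of G, grouped in chains, with
   their inverses. *)
Definition groups_chains (s : side) (G : ctx) (A : ty) (p : tm) : Prop :=
  exists2 cs : seq (seq nat),
    perm_eq (flatten cs) (topvars G A) /\ (forall c, c \in cs -> composable G c)
    & leaves p = flatten (map (chain_with_inv s G A) cs).

(* t^LU or t^RU, for the generic t, is a composite of an associator a, a
   cancellation b and a unitor c. *)
Definition unit_shape (C : choice_can) (s : side) (G : ctx) (B : ty) (u v : tm)
    (G' : ctx) (p : seq nat) : Prop :=
  let A := Arr B u v in
  let D := gen_ctx G A in
  let t := Coh G A (ids (size G)) in
  let ti := can_inv s G' p G B u v (ids (size G)) (gen_es G A) in
  let T := pick_side s (Arr B v v) (Arr B u u) in
  let q0 := unit_dom s B u v t ti in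
  let q3 := unit_cod s B u v in
  exists q1 q2 a b c,
  [/\ [/\ wf_tm C D a (Arr T q0 q1), wf_tm C D b (Arr T q1 q2)
        & wf_tm C D c (Arr T q2 q3)],
      [/\ coh_dim_le (dim1 A) a, coh_built (atom_inv s G A) a
        & groups_chains s G A q1],
      coh_built (atom_unit s G A) b,
      coh_dim_le (dim1 A) c /\ coh_built (atom_var G) c
    & [\/ cunit C s G A = compn T q0 q1 q3 a (compn T q1 q2 q3 b c),
          cunit C s G A = compn T q0 q2 q3 (compn T q0 q1 q2 a b) c
        | cunit C s G A = compn3 T q0 q1 q2 q3 a b c]].

(* The pairs (G, A) with A = u ->_B v in which the choice is made, together with
   G^op.  The last two conditions say that v ->_B u is a full type of G^op, so that
   coh_{G^op, v -> u} is meaningful; since [full] is about the raw occurrences of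
   variables in u and v, they do not follow from the others as they do in CaTT. *)
Definition invertible_coh (C : choice_can) (G : ctx) (B : ty) (u v : tm)
    (G' : ctx) (p : seq nat) : Prop :=
  [/\ [/\ pasting G, wf_ty C G (Arr B u v) & full G (Arr B u v)],
      dimC G = dim1 (Arr B u v),
      is_op (dim1 (Arr B u v)) G G' p,
      wf_ty C G' (substT (Arr B v u) (map Var p))
    & full G' (substT (Arr B v u) (map Var p))].

(* [adm_fam] gives the types of t^LU and t^RU and says that {-} is a family of
   invertibility structures on the top-dimensional arguments of these coherence
   terms; [adm_susp] is stability under suspension. *)
Record admissible (C : choice_can) : Prop := Admissible {
  adm_unit : forall s G B u v G' p,
    invertible_coh C G B u v G' p -> unit_shape C s G B u v G' p;
  adm_fam : forall s G B u v G' p,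
    invertible_coh C G B u v G' p ->
    let A := Arr B u v in
    let t := Coh G A (ids (size G)) in
    let ti := can_inv s G' p G B u v (ids (size G)) (gen_es G A) in
    wf_tm C (gen_ctx G A) (Can (cunit C s G A) (cfam C s G A))
      (Inv (unit_ty s B u v t ti) (cunit C s G A))
    /\ (forall f, List.In f (cfam C s G A) -> inv_built s (gen_es G A) f);
  adm_susp : forall s G A,
    pasting G -> wf_ty C G A -> full G A -> dimC G = dim1 A ->
    cunit C s (suspC G) (suspT A) = suspt (cunit C s G A)
    /\ cfam C s (suspC G) (suspT A) = map suspt (cfam C s G A)
}.

(* Main.v *)
Require Import Defs.
From mathcomp Require Import all_boot.

(** The composite f * g is by definition the coherence over the chain
    x -f-> y -g-> z, suspended n = dim A + 1 times and then substituted.  It is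
    therefore literally one coherence term coh_{G, B}[d], where G is the n-fold
    suspension of the chain and d lists the iterated boundary of A followed by
    x, y, f, z, g ([compnE]).  The variables of G of the same dimension as this
    composite are exactly the two arrows, which d sends to f and g
    ([topvars_chain2]); hence the constructor can, fed with the given
    invertibility structures of f and g, yields one for f * g.

    What has to be checked is that the coherence is well typed ([wf_comp]).
    The iterated suspensions of the type * are explicit: sphere n.+1 is
    Arr (sphere n) (Var n.*2) (Var n.*2.+1) ([sphereS]).  The suspended chain can
    thus be written out ([iter_suspC_chain2]), and its well-formedness
    ([wf_comp_ty]), the fullness of B ([full_chain2]) and the typing of d are
    read off its entries; only for pasting diagrams is one suspension analysed
    at a time ([pasting_susp]). *)

Set Implicit Arguments.
Unset Strict Implicit.
Unset Printing Implicit Defensive.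

(** * Suspended identities and sphere types *)

Lemma ids_susp k : [:: Var 0, Var 1 & map suspt (ids k)] = ids k.+2.
Proof.
rewrite /ids /mkseq -map_comp /= -[2]addn0 iotaDl -map_comp.
by congr [:: _, _ & _]; apply: eq_map.
Qed.

Lemma comps_ids d : comps (ids (size d)) d = d.
Proof.
by rewrite /comps /ids /mkseq -map_comp; apply: (mkseq_nth (Var 0)).
Qed.

Lemma size_iter_suspC n G : size (iter n suspC G) = n.*2 + size G.
Proof. by elim: n => //= n IH; rewrite size_map IH. Qed.

Lemma iter_suspt_Coh n G A :
  iter n suspt (Coh G A (ids (size G))) =
  Coh (iter n suspC G) (iter n suspT A) (ids (size (iter n suspC G))).
Proof. by elim: n => //= n ->; rewrite /= ids_susp size_map. Qed.

Lemma iter_suspT_Arr n i j :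
  iter n suspT (Arr Star (Var i) (Var j)) =
  Arr (sphere n) (Var (n.*2 + i)) (Var (n.*2 + j)).
Proof. by elim: n => //= n ->. Qed.

Lemma sphereS n : sphere n.+1 = Arr (sphere n) (Var n.*2) (Var n.*2.+1).
Proof.
by rewrite /sphere iterSr (iter_suspT_Arr n 0 1) addn0 addn1.
Qed.

Lemma dim1_sphere n : dim1 (sphere n) = n.
Proof. by elim: n => // n IH; rewrite sphereS /= IH. Qed.

Lemma globular_sphere n : globular (sphere n).
Proof. by case: n => // n; rewrite sphereS. Qed.

Lemma occT_sphere n i : i < n.*2 -> occT i (sphere n).
Proof.
elim: n => // n IH; rewrite doubleS !ltnS sphereS /= leq_eqVlt.
case/orP => [->|]; first by rewrite !orbT.
by rewrite ltnS leq_eqVlt => /orP[->|/IH ->]; rewrite ?orbT.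
Qed.

(** Disks and suspended chains all begin with such a list of iterated
    endpoints, two of each dimension.  Odd lengths are allowed so that its
    well-formedness is proved one variable at a time. *)
Definition spheres (m : nat) : ctx := mkseq (fun i => sphere i./2) m.

Definition starts_with_spheres (m : nat) (G : ctx) : Prop :=
  m <= size G /\ forall i, i < m -> nth_ty G i = sphere i./2.

Lemma starts_spheres k m l :
  k <= m -> starts_with_spheres k (spheres m ++ l).
Proof.
move=> km; split; first by rewrite size_cat size_mkseq (leq_trans km) ?leq_addr.
move=> i ik; have im := leq_trans ik km.
by rewrite /nth_ty nth_cat size_mkseq im nth_mkseq.
Qed.

Lemma starts_le k m G :
  k <= m -> starts_with_spheres m G -> starts_with_spheres k G.
Proof.
move=> km [sG eG]; split=> [|i ik]; first exact: leq_trans sG.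
by rewrite eG // (leq_trans ik).
Qed.

Lemma wf_sphere C n G :
  wf_ctx C G -> starts_with_spheres n.*2 G -> wf_ty C G (sphere n).
Proof.
move=> wG; elim: n => [|n IH] [sG eG]; first exact: wf_Star.
rewrite doubleS in sG eG; rewrite sphereS.
apply: wf_Arr; first exact: globular_sphere.
- by apply/IH/(starts_le (m := n.*2.+2)) => //; rewrite ltnW.
- have := wf_Var wG (ltnW sG); by rewrite eG // doubleK.
- have := wf_Var wG sG; by rewrite eG //= uphalf_double.
Qed.

Lemma wf_spheres C m : wf_ctx C (spheres m).
Proof.
elim: m => [|m IH]; first exact: wf_nil.
rewrite /spheres mkseqS; apply: wf_rcons; apply: wf_sphere => //.
rewrite -[mkseq _ _]cats0; apply: starts_spheres.
by rewrite -{2}(odd_double_half m) leq_addl.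
Qed.

(** * The suspended chain *)

(** The two endpoints of the first arrow continue the list of iterated
    endpoints, and its type is the next sphere type. *)
Lemma iter_suspC_chain2 n :
  iter n suspC chain2 =
  spheres n.*2.+2 ++
    [:: sphere n.+1; sphere n; Arr (sphere n) (Var n.*2.+1) (Var n.*2.+3)].
Proof.
elim: n => // n IH.
have E m : suspC (spheres m) = spheres m.+2.
  rewrite /suspC /spheres /mkseq /= -map_comp -[2]addn0 iotaDl -map_comp.
  by congr [:: _, _ & _]; apply: eq_map.
by rewrite doubleS -E iterS IH /suspC map_cat.
Qed.

Lemma ps_susp G x A : ps G x A -> ps (suspC G) (suspt x) (suspT A).
Proof.
elim=> [|{}G f {}x {}A y _ IH|{}G {}x {}A _ IH] /=.
- exact: (ps_up ps_pt).
- exact: (ps_down IH).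
- rewrite /suspC !map_rcons -!rcons_cons.
  by have := ps_up IH; rewrite /= size_map.
Qed.

Lemma pasting_susp G : pasting G -> pasting (suspC G).
Proof. by case=> x /ps_susp H; exists (Var 1); apply: ps_down H. Qed.

Lemma pasting_chain2 n : pasting (iter n suspC chain2).
Proof.
elim: n => [|n IH]; last exact: pasting_susp.
exists (Var 3); apply: ps_down.
exact: (ps_up (ps_down (ps_up ps_pt))).
Qed.

Lemma nth_chain2 n k :
  nth_ty (iter n suspC chain2) (n.*2 + k) =
  nth Star [:: sphere n; sphere n; Arr (sphere n) (Var n.*2) (Var n.*2.+1);
               sphere n; Arr (sphere n) (Var n.*2.+1) (Var n.*2.+3)] k.
Proof.
rewrite -sphereS iter_suspC_chain2 /nth_ty nth_cat size_mkseq -addn2 ltn_add2l.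
case: ltnP => k2; last first.
  rewrite subnDl; case: k k2 => [|[|k]] // _.
  by rewrite subSS subSS subn0.
rewrite nth_mkseq ?ltn_add2l // halfD doubleK odd_double.
by case: k k2 => [|[|]] // _; rewrite addn0.
Qed.

Lemma starts_chain2 n : starts_with_spheres n.*2.+2 (iter n suspC chain2).
Proof. by rewrite iter_suspC_chain2; apply: starts_spheres. Qed.

Lemma dimC_chain2 n : dimC (iter n suspC chain2) = n.+1.
Proof.
apply/eqP; rewrite eqn_leq; apply/andP; split.
- rewrite iter_suspC_chain2 /dimC big_cat geq_max; apply/andP; split.
    rewrite /spheres /mkseq big_map big_seq; apply: (big_ind (fun k => k <= n.+1)) => //.
      by move=> a b ha hb; rewrite geq_max ha.
    move=> i; rewrite mem_iota add0n dim1_sphere => /andP[_ /ltnW/half_leq].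
    by rewrite -doubleS doubleK.
  rewrite !big_cons big_nil !dim1_sphere [dim1 (Arr _ _ _)]/= dim1_sphere.
  by rewrite !geq_max leqnn leqnSn.
- rewrite iter_suspC_chain2 /dimC big_cat leq_max; apply/orP; right.
  by rewrite big_cons dim1_sphere leq_maxl.
Qed.

(** The suspension of the type of the composite of the chain. *)
Definition comp_ty (n : nat) : ty :=
  Arr (sphere n) (Var n.*2) (Var n.*2.+3).

Lemma dim1_comp_ty n : dim1 (comp_ty n) = n.+1.
Proof. by rewrite /= dim1_sphere. Qed.

Lemma iter_suspC_chain2_rcons n :
  iter n suspC chain2 =
  rcons (rcons (rcons (spheres n.*2.+2) (sphere n.+1)) (sphere n))
    (Arr (sphere n) (Var n.*2.+1) (Var n.*2.+3)).
Proof. by rewrite iter_suspC_chain2 -!cats1 -!catA. Qed.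

Lemma wf_chain2_last C n :
  wf_ty C (rcons (rcons (spheres n.*2.+2) (sphere n.+1)) (sphere n))
    (Arr (sphere n) (Var n.*2.+1) (Var n.*2.+3)).
Proof.
have starts k l : k <= n.*2.+2 -> starts_with_spheres k (spheres n.*2.+2 ++ l).
  exact: starts_spheres.
have w1 : wf_ctx C (rcons (spheres n.*2.+2) (sphere n.+1)).
  by have := wf_spheres C n.*2.+3; rewrite /spheres mkseqS -doubleS doubleK.
have w2 : wf_ctx C (rcons (rcons (spheres n.*2.+2) (sphere n.+1)) (sphere n)).
  apply: wf_rcons; apply: wf_sphere => //.
  by rewrite -cats1; apply: starts; rewrite ltnW // ltnW.
apply: wf_Arr; first exact: globular_sphere.
- apply: wf_sphere => //; rewrite -!cats1 -catA.
  by apply: starts; rewrite ltnW // ltnW.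
- have := @wf_Var C _ n.*2.+1 w2.
  rewrite !size_rcons size_mkseq /nth_ty !nth_rcons size_rcons size_mkseq.
  rewrite !ltnS leqnSn leqnn nth_mkseq //= uphalf_double; apply.
  by rewrite ltnW.
- have := @wf_Var C _ n.*2.+3 w2.
  rewrite !size_rcons size_mkseq /nth_ty !nth_rcons size_rcons size_mkseq.
  by rewrite ltnn eqxx; apply.
Qed.

Lemma wf_comp_ty C n : wf_ty C (iter n suspC chain2) (comp_ty n).
Proof.
have wG : wf_ctx C (iter n suspC chain2).
  by rewrite iter_suspC_chain2_rcons; apply/wf_rcons/wf_chain2_last.
have [sG eG] := starts_chain2 n.
apply: wf_Arr; first exact: globular_sphere.
- by apply/wf_sphere/(starts_le _ (starts_chain2 n)) => //; rewrite ltnW.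
- by have := wf_Var wG (ltnW sG); rewrite eG // doubleK.
- have := @wf_Var C _ (n.*2 + 3) wG.
  by rewrite nth_chain2 size_iter_suspC ltn_add2l addn3; apply.
Qed.

(** The second clause of fullness holds.  A variable of dimension at most n is an
    iterated endpoint, which occurs in the sphere type, or one of the three
    points of the chain.  Among these, only the first point is not the target of
    an arrow and only the last one is not the source of an arrow, and they are
    the two sides of the type. *)
Lemma full_chain2 n : full (iter n suspC chain2) (comp_ty n).
Proof.
right; rewrite dimC_chain2 dim1_sphere.
have split_var i : i < size (iter n suspC chain2) ->
    i < n.*2 \/ exists2 k, k < 5 & i = n.*2 + k.
  rewrite size_iter_suspC; case: (ltnP i n.*2) => [|le_i lt_i]; first by left.
  by right; exists (i - n.*2); rewrite ?ltn_subLR ?subnKC.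
have arrow k : k < 5 -> n.*2 + k < size (iter n suspC chain2).
  by rewrite size_iter_suspC ltn_add2l.
have tgt2 := nth_chain2 n 2; rewrite /= in tgt2.
have tgt4 := nth_chain2 n 4; rewrite /= in tgt4.
split=> // i /split_var[lt_i _ _|[k lt_k ->]].
- by rewrite /uses occT_sphere ?orbT.
- rewrite nth_chain2; move: k lt_k => [|[|[|[|[|]]]]] //= _.
  + by rewrite addn0 /uses /= eqxx.
  + move=> _ []; exists (n.*2 + 2); first exact: arrow.
    by rewrite tgt2 addn1; do 2 eexists.
  + by rewrite dim1_sphere ltnn.
  + move=> _ []; exists (n.*2 + 4); first exact: arrow.
    by rewrite tgt4 addn3; do 2 eexists.
  + by rewrite dim1_sphere ltnn.
- by rewrite /uses occT_sphere ?orbT.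
- rewrite nth_chain2; move: k lt_k => [|[|[|[|[|]]]]] //= _.
  + move=> _ []; exists (n.*2 + 2); first exact: arrow.
    by rewrite tgt2 addn0; do 2 eexists.
  + move=> _ []; exists (n.*2 + 4); first exact: arrow.
    by rewrite tgt4 addn1; do 2 eexists.
  + by rewrite dim1_sphere ltnn.
  + by rewrite addn3 /uses /= eqxx.
  + by rewrite dim1_sphere ltnn.
Qed.

Lemma topvars_chain2 n :
  topvars (iter n suspC chain2) (comp_ty n) = [:: n.*2.+2; n.*2.+4].
Proof.
rewrite /topvars dim1_comp_ty size_iter_suspC iotaD filter_cat add0n.
have -> : [seq i <- iota 0 n.*2 |
            dim1 (nth_ty (iter n suspC chain2) i) == n.+1] = [::].
  rewrite (@eq_in_filter _ _ pred0) ?filter_pred0 // => i.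
  rewrite mem_iota add0n => /andP[_ lt_i].
  have [_ ->] := starts_chain2 n; last by rewrite ltnW // ltnW.
  by rewrite dim1_sphere ltn_eqF // ltnS -(doubleK n) half_leq // ltnW.
rewrite cat0s -[X in iota X _]addn0 iotaDl filter_map.
rewrite (eq_filter (fun k => congr1 (fun A => dim1 A == n.+1) (nth_chain2 n k))).
by rewrite /= !dim1_sphere eqxx ltn_eqF //= addn2 addn4.
Qed.

(** * Instances of the suspended chain *)

Lemma size_bound A : size (bound A) = (dim1 A).*2.
Proof. by elim: A => //= A IH u v; rewrite size_cat IH addn2. Qed.

Lemma nth_bound A l k :
  nth (Var 0) (bound A ++ l) ((dim1 A).*2 + k) = nth (Var 0) l k.
Proof. by rewrite nth_cat size_bound ltnNge leq_addr addKn. Qed.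

(** The identity substitution of the chain suspends to the identity, and
    composing with it returns the given substitution. *)
Lemma compnE A x y z f g :
  compn A x y z f g =
  Coh (iter (dim1 A) suspC chain2) (comp_ty (dim1 A))
    (bound A ++ [:: x; y; f; z; g]).
Proof.
rewrite /compn.
have -> : comp0 = Coh chain2 (Arr Star (Var 0) (Var 3)) (ids (size chain2)).
  by [].
rewrite iter_suspt_Coh iter_suspT_Arr addn0 addn3 /=; congr Coh.
rewrite size_iter_suspC -size_bound -(size_cat (bound A) [:: x; y; f; z; g]).
exact: comps_ids.
Qed.

Lemma wf_Arr_inv C D A u v :
  wf_ty C D (Arr A u v) ->
  [/\ globular A, wf_ty C D A, wf_tm C D u A & wf_tm C D v A].
Proof. by move=> H; inversion H. Qed.

(** Every globular type is the instance of the sphere type at its own boundary;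
    well-formedness excludes the arrow types over some Inv, whose boundary
    forgets that base.  The extra entries l make it usable for every
    substitution that starts with this boundary. *)
Lemma substT_bound C D A l :
  wf_ty C D A -> globular A -> substT (sphere (dim1 A)) (bound A ++ l) = A.
Proof.
elim: A l => // A IH u v l /wf_Arr_inv[gA wA _ _] _; rewrite sphereS /=.
rewrite -catA IH //.
have := nth_bound A [:: u, v & l] 0; rewrite addn0 => ->.
by have := nth_bound A [:: u, v & l] 1; rewrite addn1 => ->.
Qed.

Lemma wf_sub_bound C D A :
  wf_ctx C D -> wf_ty C D A -> globular A ->
  wf_sub C D (bound A) (spheres (dim1 A).*2).
Proof.
move=> wD; elim: A => //= [_ _|A IH u v /wf_Arr_inv[gA wA wu wv] _].
  exact: wf_snil.
have sub0 l : substT (sphere (dim1 A)) (bound A ++ l) = A.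
  exact: substT_bound wA gA.
have wS m : (dim1 A).*2 <= m -> wf_ty C (spheres m) (sphere (dim1 A)).
  move=> le_m; apply: wf_sphere; first exact: wf_spheres.
  by rewrite -[spheres _]cats0; apply: starts_spheres.
have -> : bound A ++ [:: u; v] = rcons (rcons (bound A) u) v.
  by rewrite -!cats1 -catA.
have -> : spheres (dim1 A).*2.+2 = rcons (rcons (spheres (dim1 A).*2)
    (sphere (dim1 A))) (sphere (dim1 A)).
  by rewrite /spheres !mkseqS /= doubleK uphalf_double.
apply: wf_srcons; last by rewrite -cats1 sub0.
  apply: wf_srcons; [exact: IH | exact: wS | by rewrite -[bound A]cats0 sub0].
have := wS (dim1 A).*2.+1 (leqnSn _).
by rewrite /spheres mkseqS doubleK.
Qed.

(** The first entries of d, up to y, form the boundary of the type of f, so that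
    they are typed by [wf_sub_bound]; only f, z and g are then left. *)
Lemma wf_comp C D A x y z f g :
  wf_ctx C D -> wf_ty C D A -> globular A ->
  wf_tm C D x A -> wf_tm C D y A -> wf_tm C D z A ->
  wf_tm C D f (Arr A x y) -> wf_tm C D g (Arr A y z) ->
  let n := dim1 A in
  let d := bound A ++ [:: x; y; f; z; g] in
  wf_tm C D (Coh (iter n suspC chain2) (comp_ty n) d)
    (substT (comp_ty n) d).
Proof.
move=> wD wA gA wx wy wz wf wg n d.
apply: wf_Coh; [exact: pasting_chain2 | exact: wf_comp_ty | exact: full_chain2 |].
have wB : wf_ty C D (Arr A x y) by apply: wf_Arr.
have sub0 l : substT (sphere n) (bound A ++ l) = A by apply: substT_bound wA gA.
have -> : d = rcons (rcons (rcons (bound (Arr A x y)) f) z) g.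
  by rewrite -!cats1 -!catA.
rewrite iter_suspC_chain2_rcons.
apply: wf_srcons; last 1 first.
- rewrite -!cats1 -!catA /= sub0.
  have := nth_bound A [:: x; y; f; z] 1; rewrite addn1 => ->.
  by have := nth_bound A [:: x; y; f; z] 3; rewrite addn3 => ->.
- apply: wf_srcons; last by rewrite -cats1 -!catA sub0.
    apply: wf_srcons; first exact: (wf_sub_bound wD wB).
      apply: wf_sphere; first exact: wf_spheres.
      by rewrite -[spheres _]cats0; apply: starts_spheres.
    by rewrite -[bound _]cats0 (substT_bound _ wB).
  apply: wf_sphere; last by rewrite -cats1; apply/starts_spheres/ltnW/ltnW.
  by have := wf_spheres C n.*2.+3; rewrite /spheres mkseqS -doubleS doubleK.
- exact: wf_chain2_last.
Qed.

Theorem proposition5p1 (C : choice_can) (hC : admissible C)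
    (G : ctx) (A : ty) (x y z f g : tm)
    (hG : wf_ctx C G) (hA : wf_ty C G A) (hglob : globular A)
    (hx : wf_tm C G x A) (hy : wf_tm C G y A) (hz : wf_tm C G z A)
    (hf : wf_tm C G f (Arr A x y)) (hg : wf_tm C G g (Arr A y z)) :
  invertible C G (Arr A x y) f ->
  invertible C G (Arr A y z) g ->
  invertible C G (Arr A x z) (compn A x y z f g).
Proof.
case=> ef hef [eg heg]; rewrite compnE.
set n := dim1 A; set d := bound A ++ _.
have sub0 : substT (sphere n) d = A by apply: substT_bound hA hglob.
have nthd k : nth (Var 0) d (n.*2 + k) = nth (Var 0) [:: x; y; f; z; g] k.
  exact: nth_bound.
have ndE : [/\ nth (Var 0) d n.*2 = x, nth (Var 0) d n.*2.+1 = y,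
    nth (Var 0) d n.*2.+2 = f, nth (Var 0) d n.*2.+3 = z
  & nth (Var 0) d n.*2.+4 = g].
  by rewrite -addn4 -addn3 -addn2 -addn1 -{1}[n.*2]addn0 !nthd.
case: ndE => dx dy df dz dg.
have compT : substT (comp_ty n) d = Arr A x z by rewrite /= sub0 dx dz.
exists (Can (Coh (iter n suspC chain2) (comp_ty n) d) [:: ef; eg]).
rewrite -compT; apply: wf_Can; rewrite ?topvars_chain2 //.
  exact: (wf_comp hG).
have ty2 := nth_chain2 n 2; have ty4 := nth_chain2 n 4.
rewrite addn2 in ty2; rewrite addn4 in ty4.
move=> [|[|j]] // _ k.
- have -> : k = n.*2.+2 by [].
  by rewrite ty2 /= sub0 dx dy df.
- have -> : k = n.*2.+4 by [].
  by rewrite ty4 /= sub0 dy dz dg.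
Qed.
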